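(* Suppose the normal basis $\Psi(x,u)=\begin{bmatrix}I\\ G(u)\end{bmatrix}H(x)$ has one of the following two structures: (linear) $H(x)=\begin{bmatrix}\bar H(x)\\ 1\end{bmatrix}$ for some $\bar H:\mathcal X\to\mathbb R^{n_{\mathcal H}-1}$, and $G(u)=[\,0_{m\times(n_{\mathcal H}-1)},\ u\,]$; or (bilinear) $G(u)=[u_1I,\ u_2I,\ \dots,\ u_mI]^T$ with $I$ the $n_{\mathcal H}\times n_{\mathcal H}$ identity. Assume that $\Psi(X,U)$ and $H(X^+)$ have full row rank. For $h=v_h^*H$ with $v_h\in\mathbb C^{n_{\mathcal H}}$, the predictor $\mathfrak P_{h\circ\mathcal T}$ then has the form $\mathfrak P_{h\circ\mathcal T}(x,u)=v_h^*(A_{11}H(x)+A_{12}u)$ in the linear case, and $\mathfrak P_{h\circ\mathcal T}(x,u)=v_h^*\big(A_{11}+\sum_{i=1}^mu_iB_i\big)H(x)$ with $A_{12}=[B_1,\dots,B_m]$, $B_i\in\mathbb R^{n_{\mathcal H}\times n_{\mathcal H}}$, in the bilinear case; and in either case $$\max_{h\in\mathcal H,\ h\ne0}\ \sqrt{\frac{\sum_{i=1}^N|h(x_i^+)-\mathfrak P_{h\circ\mathcal T}(x_i,u_i)|^2}{\sum_{i=1}^N|h(x_i^+)|^2}}=\sqrt{\lambda_{\max}(M_{CC})},$$ where $\mathcal H=\operatorname{span}_{\mathbb C}(H)$ and $M_{CC}$ is the control consistency matrix computed with this $\Psi$.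
   Context: System: $x^+=\mathcal T(x,u)$ with $\mathcal T:\mathcal X\times\mathcal U\to\mathcal X$, $\mathcal X\subseteq\mathbb R^n$, $\mathcal U\subseteq\mathbb R^m$. Normal basis: $H:\mathcal X\to\mathbb R^{n_{\mathcal H}}$ and $G:\mathcal U\to\mathbb R^{(n_\Psi-n_{\mathcal H})\times n_{\mathcal H}}$ are given, and $\Psi:\mathcal X\times\mathcal U\to\mathbb R^{n_\Psi}$ is $\Psi(x,u)=\begin{bmatrix}I\\ G(u)\end{bmatrix}H(x)$, with $I$ the $n_{\mathcal H}\times n_{\mathcal H}$ identity; the components of $\Psi$ are linearly independent functions. Data: $X,X^+\in\mathbb R^{n\times N}$, $U\in\mathbb R^{m\times N}$ with columns $x_i\in\mathcal X$, $x_i^+$, $u_i\in\mathcal U$ satisfying $x_i^+=\mathcal T(x_i,u_i)$, $i=1,\dots,N$. Write $\Psi(X,U)=[\Psi(x_1,u_1),\dots,\Psi(x_N,u_N)]$, $\Psi(X^+,U)=[\Psi(x_1^+,u_1),\dots,\Psi(x_N^+,u_N)]$, $H(X^+)=[H(x_1^+),\dots,H(x_N^+)]$. $^\dagger$ is the Moore–Penrose pseudoinverse and $^*$ the conjugate transpose. Predictor: let $A=\Psi(X^+,U)\Psi(X,U)^\dagger$, partitioned as $A=\begin{bmatrix}A_{11}&A_{12}\\ A_{21}&A_{22}\end{bmatrix}$ with $A_{11}\in\mathbb R^{n_{\mathcal H}\times n_{\mathcal H}}$. For $h=v_h^*H$, $v_h\in\mathbb C^{n_{\mathcal H}}$, the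 predictor of $h\circ\mathcal T$ is defined by $\mathfrak P_{h\circ\mathcal T}(x,u)=v_h^*\,(A_{11}+A_{12}G(u))\,H(x)$. Control consistency matrix: $M_{CC}=I-A_fA_b$ with $A_f=H(X^+)\Psi(X,U)^\dagger$, $A_b=\Psi(X,U)H(X^+)^\dagger$. Under the full-row-rank assumption its eigenvalues are real, and $\lambda_{\max}(M_{CC})$ denotes the largest one. *)

(* Defs.v *)
From HB Require Import structures.
From mathcomp Require Import all_boot all_order all_algebra.
From mathcomp Require Import complex.
From mathcomp Require Import boolp classical_sets reals.

Set Implicit Arguments.
Unset Strict Implicit.
Unset Printing Implicit Defensive.

Import Order.TTheory GRing.Theory Num.Theory.
Local Open Scope ring_scope.
Local Open Scope classical_set_scope.
Local Open Scope sesquilinear_scope.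

Definition moore_penrose (R : realType) (m n : nat)
    (A : 'M[R]_(m, n)) (P : 'M[R]_(n, m)) : Prop :=
  [/\ A *m P *m A = A, P *m A *m P = P,
      (A *m P)^T = A *m P & (P *m A)^T = P *m A].

(* The default value 0 is never used: see [pinvP] and [moore_penrose_unique]. *)
Definition pinv (R : realType) (m n : nat) (A : 'M[R]_(m, n)) : 'M[R]_(n, m) :=
  xget 0 [set P | moore_penrose A P].

Lemma gram_row_free (R : realType) (r n : nat) (B : 'M[R]_(r, n)) :
  row_free B -> B *m B^T \in unitmx.
Proof.
move=> Bf; rewrite -row_free_unit -kermx_eq0; apply/rowV0P => v /sub_kermxP vB.
have ww : (v *m B) *m (v *m B)^T = 0.
  by rewrite trmx_mul mulmxA -[v *m B *m _]mulmxA vB mul0mx.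
apply/eqP; rewrite -(mulmx_free_eq0 v Bf); move: (v *m B) ww => w ww.
have s0 : \sum_j w 0 j ^+ 2 = 0.
  have : (w *m w^T) 0 0 = 0 by rewrite ww mxE.
  by rewrite mxE => s0; rewrite -[RHS]s0; apply: eq_bigr => j _; rewrite mxE expr2.
apply/eqP/rowP => j; rewrite [RHS]mxE; apply/eqP; rewrite -sqrf_eq0.
by rewrite (psumr_eq0P _ s0) // => k _; rewrite sqr_ge0.
Qed.

Lemma pinvP (R : realType) (m n : nat) (A : 'M[R]_(m, n)) :
  moore_penrose A (pinv A).
Proof.
rewrite /pinv; apply: (@xgetPex _ 0 [set P | moore_penrose A P]).
have [r [C [B [AE Cf Bf]]]] : exists r (C : 'M[R]_(m, r)) (B : 'M[R]_(r, n)),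
    [/\ A = C *m B, row_free C^T & row_free B].
  exists (\rank A), (col_base A), (row_base A).
  by rewrite mulmx_base row_base_free /row_free mxrank_tr; split=> //; exact: col_base_full.
have Bu : B *m B^T \in unitmx by exact: gram_row_free.
have Cu : C^T *m C \in unitmx by rewrite -{2}[C]trmxK; exact: gram_row_free.
pose iB := invmx (B *m B^T); pose iC := invmx (C^T *m C).
have BB : B *m (B^T *m iB) = 1%:M by rewrite mulmxA mulmxV.
have CC : iC *m C^T *m C = 1%:M by rewrite -mulmxA mulVmx.
have sB : iB^T = iB by rewrite trmx_inv trmx_mul trmxK.
have sC : iC^T = iC by rewrite trmx_inv trmx_mul trmxK.
have AP : A *m (B^T *m iB *m (iC *m C^T)) = C *m (iC *m C^T).
  by rewrite AE -mulmxA (mulmxA B) BB mul1mx.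
have PA : (B^T *m iB *m (iC *m C^T)) *m A = B^T *m iB *m B.
  by rewrite AE -(mulmxA _ (iC *m C^T)) (mulmxA (iC *m C^T)) CC mul1mx.
exists (B^T *m iB *m (iC *m C^T)); split.
- by rewrite AP {1}AE -mulmxA (mulmxA (iC *m C^T)) CC mul1mx.
- by rewrite PA -mulmxA (mulmxA B) BB mul1mx.
- by rewrite AP !trmx_mul trmxK sC mulmxA.
- by rewrite PA !trmx_mul trmxK sB mulmxA.
Qed.

Lemma moore_penrose_unique (R : realType) (m n : nat) (A : 'M[R]_(m, n))
    (P Q : 'M[R]_(n, m)) :
  moore_penrose A P -> moore_penrose A Q -> P = Q.
Proof.
move=> [a1 a2 a3 a4] [b1 b2 b3 b4].
have E1 : A *m P = A *m Q.
  rewrite -{1}b1 -mulmxA -b3 -a3 -trmx_mul.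
  by rewrite [A *m P *m _]mulmxA a1.
have E2 : P *m A = Q *m A.
  rewrite -{1}b1 !mulmxA -[P *m A *m Q *m A]mulmxA -a4 -b4 -trmx_mul.
  by rewrite -!mulmxA [A *m (P *m A)]mulmxA a1.
by rewrite -a2 E2 -mulmxA E1 mulmxA b2.
Qed.

(* Psi(x, u) = [I; G(u)] H(x); here q stands for n_Psi - n_H. *)
Definition Psi (R : realType) (S V : Type) (nH q : nat)
    (H : S -> 'cV[R]_nH) (G : V -> 'M[R]_(q, nH)) (x : S) (u : V) :
    'cV[R]_(nH + q) :=
  col_mx 1%:M (G u) *m H x.

Definition lin_indep_components (R : realType) (S V : Type) (k : nat)
    (F : S -> V -> 'cV[R]_k) : Prop :=
  forall c : 'rV[R]_k, (forall x u, c *m F x u = 0) -> c = 0.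

Definition data_mx (R : realType) (N k : nat) (f : 'I_N -> 'cV[R]_k) :
    'M[R]_(k, N) :=
  \matrix_(j, i) f i j 0.

(* The data are given by their columns: xs, xps : 'I_N -> S are the points x_i
   and x_i^+, and us : 'I_N -> V the inputs u_i. *)

Definition PsiXU (R : realType) (S V : Type) (nH q N : nat)
    (H : S -> 'cV[R]_nH) (G : V -> 'M[R]_(q, nH))
    (xs : 'I_N -> S) (us : 'I_N -> V) : 'M[R]_(nH + q, N) :=
  data_mx (fun i => Psi H G (xs i) (us i)).

Definition HX (R : realType) (S : Type) (nH N : nat)
    (H : S -> 'cV[R]_nH) (xs : 'I_N -> S) : 'M[R]_(nH, N) :=
  data_mx (fun i => H (xs i)).

Definition edmd_mx (R : realType) (S V : Type) (nH q N : nat)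
    (H : S -> 'cV[R]_nH) (G : V -> 'M[R]_(q, nH))
    (xs xps : 'I_N -> S) (us : 'I_N -> V) : 'M[R]_(nH + q) :=
  PsiXU H G xps us *m pinv (PsiXU H G xs us).

Definition A11 (R : realType) (S V : Type) (nH q N : nat)
    (H : S -> 'cV[R]_nH) (G : V -> 'M[R]_(q, nH))
    (xs xps : 'I_N -> S) (us : 'I_N -> V) : 'M[R]_nH :=
  ulsubmx (edmd_mx H G xs xps us).

Definition A12 (R : realType) (S V : Type) (nH q N : nat)
    (H : S -> 'cV[R]_nH) (G : V -> 'M[R]_(q, nH))
    (xs xps : 'I_N -> S) (us : 'I_N -> V) : 'M[R]_(nH, q) :=
  ursubmx (edmd_mx H G xs xps us).

Definition hdot (R : realType) (k : nat) (v : 'cV[R[i]]_k) (w : 'cV[R]_k) :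
    R[i] :=
  (v ^t* *m map_mx (real_complex R) w) 0 0.

Definition observable (R : realType) (S : Type) (nH : nat)
    (H : S -> 'cV[R]_nH) (v : 'cV[R[i]]_nH) : S -> R[i] :=
  fun x => hdot v (H x).

(* The predictor of h o T for h = v^* H. *)
Definition predictor (R : realType) (S V : Type) (nH q N : nat)
    (H : S -> 'cV[R]_nH) (G : V -> 'M[R]_(q, nH))
    (xs xps : 'I_N -> S) (us : 'I_N -> V) (v : 'cV[R[i]]_nH) :
    S -> V -> R[i] :=
  fun x u =>
    hdot v ((A11 H G xs xps us + A12 H G xs xps us *m G u) *m H x).

(* [normc z : R] is the modulus of z, with `|z| = (normc z)%:C. *)
Definition rel_error (R : realType) (S V : Type) (N : nat)
    (h : S -> R[i]) (p : S -> V -> R[i])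
    (xs xps : 'I_N -> S) (us : 'I_N -> V) : R :=
  Num.sqrt ((\sum_i ComplexField.Normc.normc (h (xps i) - p (xs i) (us i)) ^+ 2)
            / (\sum_i ComplexField.Normc.normc (h (xps i)) ^+ 2)).

Definition rel_errors (R : realType) (S V : Type) (nH q N : nat)
    (H : S -> 'cV[R]_nH) (G : V -> 'M[R]_(q, nH))
    (xs xps : 'I_N -> S) (us : 'I_N -> V) : set R :=
  [set r | exists (h : S -> R[i]) (v : 'cV[R[i]]_nH),
     [/\ h = observable H v, h <> (fun=> 0) &
         r = rel_error h (predictor H G xs xps us v) xs xps us]].

Definition is_max (R : realType) (E : set R) (r : R) : Prop :=
  E r /\ ubound E r.

Definition MCC (R : realType) (S V : Type) (nH q N : nat)
    (H : S -> 'cV[R]_nH) (G : V -> 'M[R]_(q, nH))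
    (xs xps : 'I_N -> S) (us : 'I_N -> V) : 'M[R]_nH :=
  let Af := HX H xps *m pinv (PsiXU H G xs us) in
  let Ab := PsiXU H G xs us *m pinv (HX H xps) in
  1%:M - Af *m Ab.

(* [l] is the largest among all complex eigenvalues of [M]. The order of R[i]
   only compares numbers with the same imaginary part, so the second clause
   also says that every eigenvalue of [M] is real. *)
Definition is_lambda_max (R : realType) (k : nat) (M : 'M[R]_k) (l : R) : Prop :=
  let MC := map_mx (real_complex R) M in
  eigenvalue MC (real_complex R l) /\
  forall mu : R[i], eigenvalue MC mu -> mu <= real_complex R l.

(* Main.v *)
Require Import Defs.
From HB Require Import structures.
From mathcomp Require Import all_boot all_order all_algebra.
From mathcomp Require Import complex.
From mathcomp Require Import boolp classical_sets reals.

Set Implicit Arguments.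
Unset Strict Implicit.
Unset Printing Implicit Defensive.

Import Order.TTheory GRing.Theory Num.Theory.
Local Open Scope ring_scope.

(* Write Y = H(X^+), P = Psi(X,U) and Q = I - P^+ P, an orthogonal projection.
   The top block row of A is Y P^+, so for h = v^* H the row of residuals is
   v^* Y Q and the squared relative error is the generalized Rayleigh quotient
   of S = Y Q Y^T and W = Y Y^T at v. Moreover M_CC W = S. Orthonormalizing the
   rows of Y, Y = L E with E E^* = I, conjugation by L turns M_CC into the
   Hermitian matrix E Q E^*, and the spectral theorem applies. *)

Local Open Scope sesquilinear_scope.

(** * Conjugate transposes and generalized Rayleigh quotients *)

Lemma adjmxM (C : numClosedFieldType) m n p (A : 'M[C]_(m, n))
    (B : 'M[C]_(n, p)) :
  (A *m B) ^t* = B ^t* *m A ^t*.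
Proof. by rewrite trmx_mul map_mxM. Qed.

Lemma adjmx_map_real (R : rcfType) m n (A : 'M[R]_(m, n)) :
  (map_mx (real_complex R) A) ^t* = map_mx (real_complex R) A^T.
Proof.
apply/matrixP => i j; rewrite !mxE; apply: conj_Creal.
by apply/complex_realP; exists (A j i).
Qed.

Lemma sum_sqr_normc (R : rcfType) N (z : 'rV[R[i]]_N) :
  real_complex R (\sum_i ComplexField.Normc.normc (z 0 i) ^+ 2) =
  (z *m z ^t*) 0 0.
Proof.
rewrite rmorph_sum mxE; apply: eq_bigr => i _.
by rewrite !mxE /= rmorphXn -normCK.
Qed.

Lemma dotmx_gt0 (C : numClosedFieldType) n (z : 'rV[C]_n) :
  z != 0 -> 0 < (z *m z ^t*) 0 0.
Proof. by move=> z0; rewrite -dotmxE dotmx_is_dotmx. Qed.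

(** Gram-Schmidt on the rows of [Y]. The factor [L] is square and its rank is at least that of
    [L *m E], which is [k], so it is invertible. *)
Lemma row_free_orthonormal_factor (C : numClosedFieldType) k N
    (Y : 'M[C]_(k, N)) :
  row_free Y ->
  exists (L : 'M[C]_k) (E : 'M[C]_(k, N)),
    [/\ L \in unitmx, E \is unitarymx & Y = L *m E].
Proof.
move=> Yf; have kN : (k <= N)%N by rewrite -(eqP Yf) rank_leq_col.
have /submxP[L YE] := schmidt_sub Y.
exists L, (schmidt Y); split=> //; last exact: schmidt_unitarymx.
rewrite -row_free_unit /row_free eqn_leq rank_leq_row /=.
by rewrite -[X in (X <= _)%N](eqP Yf) {1}YE mxrankM_maxl.
Qed.

(** With Y = L E, the matrix K = L^-1 M L satisfies L K L^* = S and is therefore Hermitian, so M is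
    similar to a real diagonal matrix D. The largest entry of D is both the top eigenvalue and the
    Rayleigh bound. *)
Lemma generalized_rayleigh_max (R : rcfType) k N (Y : 'M[R[i]]_(k, N))
    (S M : 'M[R[i]]_k) :
  (0 < k)%N -> row_free Y -> S ^t* = S -> M *m (Y *m Y ^t*) = S ->
  exists l : R,
    [/\ eigenvalue M (real_complex R l),
        forall mu, eigenvalue M mu -> mu <= real_complex R l &
        forall w : 'rV[R[i]]_k,
          (w *m S *m w ^t*) 0 0 <=
          real_complex R l * ((w *m Y) *m (w *m Y) ^t*) 0 0].
Proof.
move=> k0 Yf Sh MS.
have [L [E [Lu Eu YE]]] := row_free_orthonormal_factor Yf.
have EE : E *m E ^t* = 1%:M by exact/unitarymxP.
have Ltu : L ^t* \in unitmx by rewrite map_unitmx unitmx_tr.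
have YY : Y *m Y ^t* = L *m L ^t*.
  by rewrite YE adjmxM -mulmxA (mulmxA E) EE mul1mx.
have [K KE] : exists K, K = invmx L *m M *m L by eexists.
have KS : L *m K *m L ^t* = S.
  by rewrite KE !mulmxA mulmxV // mul1mx -MS YY mulmxA.
(* Cancel the invertible factors L^* and L in L K^* L^* = S^* = S = L K L^*. *)
have Kh : K ^t* = K.
  apply: (row_free_inj (_ : row_free (L ^t*))); first by rewrite row_free_unit.
  apply: (row_full_inj (_ : row_full L)); first by rewrite row_full_unit.
  by rewrite !mulmxA KS -[X in _ = X]Sh -KS !adjmxM trmxCK mulmxA.
have Khs : K \is hermsymmx.
  by apply/is_hermitianmxP; rewrite expr0 scale1r Kh.
have Ks : K = invmx (spectralmx K) *m diag_mx (spectral_diag K) *m spectralmx K.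
  exact/orthomx_spectralP/hermitian_normalmx.
have dr : forall i, exists r, spectral_diag K 0 i = real_complex R r.
  by move=> i; apply/complex_realP/mxOverP/hermitian_spectral_diag_real.
have Vu := spectral_unitarymx K.
move: (spectralmx K) (spectral_diag K) Vu Ks dr => V d Vu Ks dr.
have [r rE] : exists r : 'I_k -> R, forall i, d 0 i = real_complex R (r i).
  by exists (fun i => complex.Re (d 0 i)) => i; have [s ->] := dr i.
have Vun : V \in unitmx by exact: unitarymx_unit.
(* With T = L V^-1, the rows of T^-1 are eigenvectors of M; [eigenvalue] refers to row vectors. *)
have [T Tu MT] : exists2 T, T \in unitmx & M *m T = T *m diag_mx d.
  exists (L *m invmx V); first by rewrite unitmx_mul Lu unitmx_inv.
  have -> : M = L *m K *m invmx L by rewrite KE !mulmxA mulmxV // mul1mx mulmxK.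
  by rewrite mulmxA mulmxKV // Ks !mulmxA mulmxK.
case: (@arg_maxP _ R 'I_k (Ordinal k0) xpredT r isT) => i0 _ rmax.
exists (r i0); split.
- apply/eigenvalueP; exists (delta_mx 0 i0 *m invmx T).
    apply: (row_free_inj (_ : row_free T)); first by rewrite row_free_unit.
    rewrite -mulmxA MT mulmxA mulmxKV // -scalemxAl mulmxKV // -rE.
    apply/rowP => j; rewrite mul_mx_diag !mxE eqxx /= mulrC.
    by case: eqVneq => [->//|_]; rewrite !mulr0.
  rewrite mulmx_free_eq0 ?row_free_unit ?unitmx_inv //.
  apply/eqP => /rowP/(_ i0); rewrite !mxE !eqxx => /eqP.
  by rewrite oner_eq0.
(* The nonzero row z = w T satisfies z D = mu z; any nonzero coordinate j forces mu = d_j, so mu is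
   real. *)
- move=> mu /eigenvalueP[w wM w0].
  have : w *m T != 0 by rewrite mulmx_free_eq0 // row_free_unit.
  have : w *m T *m diag_mx d = mu *: (w *m T).
    by rewrite -mulmxA -MT mulmxA wM scalemxAl.
  move: (w *m T) => z zd z0.
  have /rV0Pn[j zj] := z0.
  have : mu = d 0 j.
    apply: (mulIf zj); move/rowP: zd => /(_ j).
    by rewrite mul_mx_diag !mxE => <-; rewrite mulrC.
  by move=> ->; rewrite rE lecR; exact: (rmax j).
(* In the coordinates z the two forms become the sums of d_j |z_j|^2 and of |z_j|^2, which compare
   term by term. *)
- move=> w; pose z := w *m L *m V ^t*.
  have -> : (w *m Y) *m (w *m Y) ^t* = z *m z ^t*.
    rewrite adjmxM mulmxA -(mulmxA w) YY /z !adjmxM trmxCK !mulmxA.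
    by rewrite mulmxKtV.
  have -> : w *m S *m w ^t* = z *m diag_mx d *m z ^t*.
    by rewrite -KS Ks (invmx_unitary Vu) /z !adjmxM trmxCK !mulmxA.
  move: z => z; rewrite !mxE mulr_sumr; apply: ler_sum => j _.
  rewrite mul_mx_diag !mxE rE [z 0 j * _]mulrC -mulrA.
  by rewrite ler_wpM2r ?mul_conjC_ge0 // lecR; exact: (rmax j).
Qed.

(** * The projection [Q] and the data in matrix form *)

Lemma complement_proj_sym (R : realType) m n (A : 'M[R]_(m, n)) :
  (1%:M - pinv A *m A)^T = 1%:M - pinv A *m A.
Proof. by have [_ _ _ h] := pinvP A; rewrite linearB /= h trmx1. Qed.

Lemma complement_proj_idem (R : realType) m n (A : 'M[R]_(m, n)) :
  (1%:M - pinv A *m A) *m (1%:M - pinv A *m A) = 1%:M - pinv A *m A.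
Proof.
have [_ h _ _] := pinvP A.
by rewrite mulmxBr mulmx1 mulmxBl mul1mx mulmxA h subrr subr0.
Qed.

Section RelErrors.
Variables (R : realType) (S V : Type) (nH q N : nat).
Variables (H : S -> 'cV[R]_nH) (G : V -> 'M[R]_(q, nH)).
Variables (xs xps : 'I_N -> S) (us : 'I_N -> V).

Let Y := HX H xps.
Let P := PsiXU H G xs us.
Let Q := 1%:M - pinv P *m P.
Local Notation mC := (map_mx (real_complex R)).

(** Since Y^+ Y is symmetric, Y^+ Y Y^T = Y^T. The left side thus reduces to Y Q Y^T, and Q = Q
    Q^T. *)
Lemma MCC_gram : MCC H G xs xps us *m (Y *m Y^T) = Y *m Q *m (Y *m Q)^T.
Proof.
rewrite trmx_mul complement_proj_sym -[RHS]mulmxA (mulmxA Q).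
rewrite complement_proj_idem /MCC -/Y -/P /Q.
have pY : pinv Y *m (Y *m Y^T) = Y^T.
  have [h _ _ s] := pinvP Y.
  by rewrite mulmxA -s -trmx_mul mulmxA h.
rewrite /= mulmxBl mulmxBl mulmxBr !mul1mx; congr (_ - _).
by rewrite -!mulmxA pY.
Qed.

(** The top block of Psi(x,u) is H(x) for every u, so the top rows of Psi(X^+,U) form Y. *)
Lemma upper_edmd_mx :
  row_mx (A11 H G xs xps us) (A12 H G xs xps us) = Y *m pinv P.
Proof.
rewrite /A11 /A12 /ulsubmx /ursubmx hsubmxK /edmd_mx -mul_usub_mx; congr (_ *m _).
apply/matrixP => i j.
by rewrite [LHS]mxE [LHS]mxE [RHS]mxE /Psi mul_col_mx mul1mx col_mxEu.
Qed.

Lemma predictorE v x u :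
  predictor H G xs xps us v x u = hdot v (Y *m pinv P *m Psi H G x u).
Proof. by rewrite -upper_edmd_mx /Psi [in RHS]mulmxA mul_row_col mulmx1. Qed.

Lemma data_mx_col k (f : 'I_N -> 'cV[R]_k) i : col i (data_mx f) = f i.
Proof. by apply/colP => j; rewrite !mxE. Qed.

Lemma hdot_mul_col k l (v : 'cV[R[i]]_k) (A : 'M[R]_(k, l)) (B : 'M[R]_(l, N)) i :
  hdot v (A *m col i B) = (v ^t* *m mC (A *m B)) 0 i.
Proof. by rewrite /hdot colE mulmxA -colE map_col colE mulmxA -colE mxE. Qed.

Lemma observable_data v i : observable H v (xps i) = (v ^t* *m mC Y) 0 i.
Proof.
rewrite /observable -(data_mx_col (fun i => H (xps i))) -/(HX H xps) -/Y.
by rewrite -[col i Y]mul1mx hdot_mul_col mul1mx.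
Qed.

(** Psi(x_i,u_i) is column i of P, so the predictions form the row v^* Y P^+ P. *)
Lemma residual_data v i :
  observable H v (xps i) - predictor H G xs xps us v (xs i) (us i) =
  (v ^t* *m mC (Y *m Q)) 0 i.
Proof.
rewrite observable_data predictorE.
rewrite -(data_mx_col (fun i => Psi H G (xs i) (us i))) -/(PsiXU H G xs us) -/P.
rewrite hdot_mul_col /Q mulmxBr mulmx1 mulmxA map_mxB mulmxBr.
by rewrite [RHS]mxE [X in _ = _ + X]mxE.
Qed.

(** * Error and energy as quadratic forms, and the maximal quotient *)

Let error v :=
  \sum_i ComplexField.Normc.normc (observable H v (xps i)
    - predictor H G xs xps us v (xs i) (us i)) ^+ 2.
Let energy v :=
  \sum_i ComplexField.Normc.normc (observable H v (xps i)) ^+ 2.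

Lemma errorE v :
  real_complex R (error v) =
  (v ^t* *m mC (Y *m Q *m (Y *m Q)^T) *m (v ^t*) ^t*) 0 0.
Proof.
rewrite /error; under eq_bigr do rewrite residual_data.
rewrite sum_sqr_normc; move: (v ^t*) (Y *m Q) => w A.
rewrite adjmxM adjmx_map_real (map_mxM (real_complex R) A A^T).
by rewrite !mulmxA.
Qed.

Lemma energyE v :
  real_complex R (energy v) =
  ((v ^t* *m mC Y) *m (v ^t* *m mC Y) ^t*) 0 0.
Proof.
by rewrite /energy; under eq_bigr do rewrite observable_data; rewrite sum_sqr_normc.
Qed.

Hypotheses (nH0 : (0 < nH)%N) (Yf : row_free Y).

Let YCf : row_free (mC Y). Proof. by rewrite row_free_map. Qed.

(** Full row rank of Y keeps v^* Y nonzero, so the quotient has a nonzero denominator. *)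
Lemma energy_gt0 v : v != 0 -> 0 < energy v.
Proof.
move=> v0; rewrite -ltcR energyE; apply: dotmx_gt0.
rewrite mulmx_free_eq0 //; apply: contra v0 => /eqP v0.
by rewrite -[v]trmxCK v0 trmx0 map_mx0.
Qed.

Lemma max_rel_error :
  exists lam : R,
    is_lambda_max (MCC H G xs xps us) lam /\
    is_max (rel_errors H G xs xps us) (Num.sqrt lam).
Proof.
have Sh : (mC (Y *m Q *m (Y *m Q)^T)) ^t* = mC (Y *m Q *m (Y *m Q)^T).
  by rewrite adjmx_map_real trmx_mul trmxK.
have MS : mC (MCC H G xs xps us) *m (mC Y *m (mC Y) ^t*) =
    mC (Y *m Q *m (Y *m Q)^T).
  by rewrite adjmx_map_real -!map_mxM MCC_gram.
have [l [le lmax lray]] := generalized_rayleigh_max nH0 YCf Sh MS.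
exists l; split=> //; split.
(* The maximum is attained at v = w^* for a row eigenvector w of M_CC: then w S = w M_CC W = l w W,
   and the quotient equals l. *)
- have /eigenvalueP[w wM w0] := le.
  have v0 : w ^t* != 0.
    by apply: contra w0 => /eqP w0; rewrite -[w]trmxCK w0 trmx0 map_mx0.
  exists (observable H (w ^t*)), (w ^t*); split=> //.
    (* If h vanished identically, its energy on the data would be 0. *)
    move=> h0; have := energy_gt0 v0; rewrite lt_neqAle => /andP[/eqP + _].
    apply; rewrite /energy h0 big1 // => i _.
    by rewrite ComplexField.Normc.normc0 expr0n.
  rewrite /rel_error -/(error _) -/(energy _); congr Num.sqrt.
  apply: (mulIf (lt0r_neq0 (energy_gt0 v0))).
  rewrite divfK ?lt0r_neq0 ?energy_gt0 //; apply: (@complexI R).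
  rewrite errorE rmorphM /= energyE !trmxCK -MS (mulmxA w) wM.
  by rewrite adjmxM -!scalemxAl [RHS]mxE !mulmxA.
- move=> _ [_ [v [-> h0 ->]]].
  have v0 : v != 0.
    apply/eqP => v0; apply: h0; apply/funext => x.
    by rewrite /observable /hdot v0 trmx0 map_mx0 mul0mx mxE.
  rewrite /rel_error -/(error _) -/(energy _) ler_wsqrtr //.
  rewrite ler_pdivrMr ?energy_gt0 // -lecR rmorphM /= errorE energyE.
  exact: lray.
Qed.
End RelErrors.

Local Close Scope sesquilinear_scope.

(** * The linear and bilinear structures *)

Theorem mainTheorem4 (R : realType) (n m N : nat)
    (X : set 'cV[R]_n) (U : set 'cV[R]_m) (T : X -> U -> X)
    (xs xps : 'I_N -> X) (us : 'I_N -> U)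
    (data : forall i, xps i = T (xs i) (us i)) :
  (* linear structure: n_H = p + 1 *)
  (forall (p : nat) (Hbar : X -> 'cV[R]_p)
      (H : X -> 'cV[R]_(p + 1)) (G : U -> 'M[R]_(m, p + 1)),
    (forall x : X, H x = col_mx (Hbar x) 1%:M) ->
    (forall u : U, G u = row_mx 0 (val u)) ->
    lin_indep_components (Psi H G) ->
    row_free (PsiXU H G xs us) ->
    row_free (HX H xps) ->
    (forall (v : 'cV[R[i]]_(p + 1)) (x : X) (u : U),
       predictor H G xs xps us v x u =
       hdot v (A11 H G xs xps us *m H x + A12 H G xs xps us *m val u)) /\
    (exists lam : R,
       is_lambda_max (MCC H G xs xps us) lam /\
       is_max (rel_errors H G xs xps us) (Num.sqrt lam)))
  /\
  (* bilinear structure: n_Psi - n_H = m n_H *)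
  (forall (nH : nat) (H : X -> 'cV[R]_nH)
      (G : U -> 'M[R]_(\sum_(i < m) nH, nH)),
    (0 < nH)%N ->
    (forall u : U, G u = \mxcol_(i < m) (val u i 0)%:M) ->
    lin_indep_components (Psi H G) ->
    row_free (PsiXU H G xs us) ->
    row_free (HX H xps) ->
    (exists B : 'I_m -> 'M[R]_nH,
       A12 H G xs xps us = \mxrow_(i < m) B i /\
       forall (v : 'cV[R[i]]_nH) (x : X) (u : U),
         predictor H G xs xps us v x u =
         hdot v ((A11 H G xs xps us + \sum_(i < m) val u i 0 *: B i) *m H x)) /\
    (exists lam : R,
       is_lambda_max (MCC H G xs xps us) lam /\
       is_max (rel_errors H G xs xps us) (Num.sqrt lam))).
Proof.
split.
- move=> p Hbar H G HE GE _ _ Yf; split; last first.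
    by apply: max_rel_error Yf; rewrite addn1.
  move=> v x u; rewrite /predictor mulmxDl -mulmxA GE HE.
  (* The final entry 1 of H(x) gives G(u) H(x) = u. *)
  by rewrite mul_row_col mul0mx add0r mulmx1.
- move=> nH H G nH0 GE _ _ Yf; split; last exact: max_rel_error Yf.
  (* The B_i are the column blocks of A_12; multiplying them by the scalar blocks u_i I of G(u)
     gives the sum of the u_i B_i. *)
  exists (submxrow (A12 H G xs xps us)); rewrite submxrowK; split=> // v x u.
  rewrite /predictor GE -{1}[A12 H G xs xps us]submxrowK mul_mxrow_mxcol.
  congr (hdot v ((_ + _) *m _)); apply: eq_bigr => i _; exact: mul_mx_scalar.
Qed.
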